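(* Let $p=2$, $X=(X_1,X_2)\in\mathbb{R}^{n\times2}$ with $\|X_1\|_2=\|X_2\|_2=1$ and $X_1^TX_2=-\hat\rho$, where $0<\hat\rho<1$, and put $\hat\varphi^2:=1-\hat\rho$, $S_0:=\{1,2\}$, $s_0:=2$. Let $\beta_1^0\ge\beta_2^0>0$ and $\lambda>0$ with $\lambda/\hat\varphi^2\le\beta_2^0$. Then the noiseless Lasso $\beta^*$ satisfies $$\|X(\beta^*-\beta^0)\|_2^2+\lambda\|\beta^*\|_1=\lambda\|\beta^0\|_1$$ and $$\|X(\beta^*-\beta^0)\|_2^2=\frac{\lambda^2s_0}{\hat\phi^2(S_0)}.$$
   Context: The noiseless Lasso is $\beta^*:=\arg\min_{\beta\in\mathbb{R}^2}\{\|X(\beta-\beta^0)\|_2^2+2\lambda\|\beta\|_1\}$. The compatibility constant for $S_0=\{1,2\}$ (all variables) is $\hat\phi^2(S_0):=\min\{s_0\|X\beta\|_2^2:\ \beta\in\mathbb{R}^2,\ \|\beta\|_1=1\}$. *)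

(* Defs.v *)
From mathcomp Require Import all_boot all_order all_algebra.
From mathcomp Require Import boolp classical_sets reals topology normedtype.
From mathcomp Require Import derive.

Set Implicit Arguments.
Unset Strict Implicit.
Unset Printing Implicit Defensive.

Import Order.TTheory GRing.Theory Num.Theory.
Import numFieldNormedType.Exports.

Local Open Scope classical_set_scope.
Local Open Scope ring_scope.

(* The canonical norm `|v| on matrices is the sup norm, so the Euclidean and
   the l1 norms of column vectors are introduced here. *)
Definition l2norm (R : realType) (n : nat) (v : 'cV[R]_n) : R :=
  Num.sqrt (\sum_(i < n) v i 0 ^+ 2).

Definition l1norm (R : realType) (p : nat) (b : 'cV[R]_p) : R :=
  \sum_(j < p) `|b j 0|.

Definition lasso_objective (R : realType) (n p : nat) (X : 'M[R]_(n, p))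
    (b0 : 'cV[R]_p) (lambda : R) (b : 'cV[R]_p) : R :=
  l2norm (X *m (b - b0)) ^+ 2 + 2 * lambda * l1norm b.

Definition is_noiseless_lasso (R : realType) (n p : nat) (X : 'M[R]_(n, p))
    (b0 : 'cV[R]_p) (lambda : R) (b : 'cV[R]_p) : Prop :=
  forall b' : 'cV[R]_p,
    lasso_objective X b0 lambda b <= lasso_objective X b0 lambda b'.

(* The squared compatibility constant for the set S of all p variables, whose
   cardinality is p. The infimum is a minimum, see full_compatibility2_min. *)
Definition full_compatibility2 (R : realType) (n p : nat)
    (X : 'M[R]_(n, p)) : R :=
  inf [set p%:R * l2norm (X *m b) ^+ 2 | b in [set b : 'cV[R]_p | l1norm b = 1]].

Lemma sqr_l2norm (R : realType) (n : nat) (v : 'cV[R]_n) :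
  l2norm v ^+ 2 = \sum_(i < n) v i 0 ^+ 2.
Proof. by rewrite sqr_sqrtr// sumr_ge0// => i _; exact: sqr_ge0. Qed.

Lemma continuous_l1norm_tr (R : realType) (p : nat) :
  continuous (fun r : 'rV[R]_p => l1norm r^T).
Proof.
apply: continuous_big => [|j _ r]; first exact: add_continuous.
under eq_fun do rewrite mxE.
by apply: continuous_comp; [exact: coord_continuous|exact: norm_continuous].
Qed.

Lemma continuous_sqr_l2norm_tr (R : realType) (n p : nat) (X : 'M[R]_(n, p))
    (b0 : 'cV[R]_p) :
  continuous (fun r : 'rV[R]_p => l2norm (X *m (r^T - b0)) ^+ 2).
Proof.
under eq_fun do rewrite sqr_l2norm.
apply: continuous_big => [|i _ r]; first exact: add_continuous.
under eq_fun do rewrite mxE expr2.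
suff h : continuous (fun s : 'rV[R]_p => \sum_j X i j * (s^T - b0) j 0).
  by apply: continuousM; exact: h.
apply: continuous_big => [|j _ s]; first exact: add_continuous.
under eq_fun do rewrite !mxE.
apply: (@continuousM _ _ (fun=> X i j) (fun s : 'rV[R]_p => s 0 j - b0 j 0)).
  exact: cst_continuous.
by apply: (@continuousB _ _ _ (fun s : 'rV[R]_p => s 0 j) (fun=> b0 j 0));
  [exact: coord_continuous|exact: cst_continuous].
Qed.

Lemma norm_coord_le_l1norm (R : realType) (p : nat) (b : 'cV[R]_p) (j : 'I_p) :
  `|b j 0| <= l1norm b.
Proof. by rewrite /l1norm (bigD1 j)//= lerDl sumr_ge0. Qed.

Lemma l1norm_ge0 (R : realType) (p : nat) (b : 'cV[R]_p) : 0 <= l1norm b.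
Proof. by rewrite /l1norm sumr_ge0. Qed.

Lemma l1norm_bounded (R : realType) (p : nat) (c : R) (A : set 'rV[R]_p) :
  (forall r, A r -> l1norm r^T <= c) -> bounded_set A.
Proof.
move=> Ac; exists `|c|; split; first exact: num_real.
move=> M cM r /Ac rc /=.
have M0 : 0 <= M by apply: le_trans (ltW cM).
rewrite /Num.norm/= mx_normrE; apply/bigmax_leP; split => //= -[i j] _ /=.
rewrite (ord1 i); apply: (le_trans _ (ltW cM)); apply: le_trans (ler_norm c).
have := norm_coord_le_l1norm r^T j; rewrite mxE => /le_trans; exact.
Qed.

Lemma exists_noiseless_lasso (R : realType) (n p : nat) (X : 'M[R]_(n, p))
    (b0 : 'cV[R]_p) (lambda : R) :
  0 < lambda -> exists b, is_noiseless_lasso X b0 lambda b.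
Proof.
move=> lambda_gt0.
pose A := [set r : 'rV[R]_p | l1norm r^T <= l1norm b0].
have cA : compact A.
  apply: bounded_closed_compact; first exact: (@l1norm_bounded _ _ (l1norm b0)).
  apply: (@preimage_closed _ _ (fun r : 'rV[R]_p => l1norm r^T) [set x | x <= _]).
    by move=> r _; exact: continuous_l1norm_tr.
  exact: closed_le.
have A0 : A !=set0 by exists b0^T; rewrite /A/= trmxK.
have cf : continuous (fun r : 'rV[R]_p => lasso_objective X b0 lambda r^T).
  move=> r.
  apply: (@continuousD _ _ _ (fun r : 'rV[R]_p => l2norm (X *m (r^T - b0)) ^+ 2)
    (fun r : 'rV[R]_p => 2 * lambda * l1norm r^T)).
    exact: continuous_sqr_l2norm_tr.
  apply: (@continuousM _ _ (fun=> 2 * lambda) (fun r : 'rV[R]_p => l1norm r^T)).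
    exact: cst_continuous.
  exact: continuous_l1norm_tr.
have [r rA rmin] := EVT_min_rV A0 cA (continuous_subspaceT cf).
exists r^T => b.
have [bA|bA] := leP (l1norm b) (l1norm b0).
  by rewrite -[b]trmxK; apply: rmin; rewrite inE /A/= trmxK.
apply: (@le_trans _ _ (lasso_objective X b0 lambda b0)).
  by have := rmin b0^T; rewrite trmxK; apply; rewrite inE /A/= trmxK.
rewrite /lasso_objective subrr mulmx0 sqr_l2norm big1; last first.
  by move=> i _; rewrite mxE expr0n.
rewrite add0r -[leLHS]add0r lerD ?sqr_ge0// ler_pM2l ?mulr_gt0//; exact: ltW.
Qed.

Lemma full_compatibility2_min (R : realType) (n p : nat) (X : 'M[R]_(n, p)) :
  (0 < p)%N ->
  exists2 b : 'cV[R]_p, l1norm b = 1 &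
    full_compatibility2 X = p%:R * l2norm (X *m b) ^+ 2 /\
    forall b', l1norm b' = 1 ->
      full_compatibility2 X <= p%:R * l2norm (X *m b') ^+ 2.
Proof.
case: p X => // p X _.
pose A := [set r : 'rV[R]_p.+1 | l1norm r^T = 1].
have cA : compact A.
  apply: bounded_closed_compact.
    by apply: (@l1norm_bounded _ _ 1) => r; rewrite /A/= => ->.
  apply: (@preimage_closed _ _ (fun r : 'rV[R]_p.+1 => l1norm r^T) [set x | x = 1]).
    by move=> r _; exact: continuous_l1norm_tr.
  exact: closed_eq.
have A0 : A !=set0.
  exists (delta_mx 0 ord0); rewrite /A/= trmx_delta /l1norm (bigD1 ord0)//=.
  rewrite mxE !eqxx normr1 big1 ?addr0// => i /negbTE i0.
  by rewrite mxE i0 normr0.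
have cf : continuous (fun r : 'rV[R]_p.+1 => p.+1%:R * l2norm (X *m r^T) ^+ 2).
  move=> r; apply: (@continuousM _ _ (fun=> p.+1%:R)
    (fun r : 'rV[R]_p.+1 => l2norm (X *m r^T) ^+ 2)).
    exact: cst_continuous.
  have -> : (fun r : 'rV[R]_p.+1 => l2norm (X *m r^T) ^+ 2) =
      (fun r => l2norm (X *m (r^T - 0)) ^+ 2).
    by apply/funext => s; rewrite subr0.
  exact: continuous_sqr_l2norm_tr.
have [r] := EVT_min_rV A0 cA (continuous_subspaceT cf).
rewrite inE => rA rmin; exists r^T => //.
have minE : full_compatibility2 X = p.+1%:R * l2norm (X *m r^T) ^+ 2.
  apply/eqP; rewrite eq_le; apply/andP; split.
    apply: ge_inf; last by exists r^T.
    by exists 0 => _ [b _ <-]; rewrite mulr_ge0// sqr_ge0.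
  apply: lb_le_inf; first by exists (p.+1%:R * l2norm (X *m r^T) ^+ 2), r^T.
  move=> _ [b b1 <-]; rewrite -[b]trmxK; apply: rmin.
  by rewrite inE /A/= trmxK.
split=> // b b1; rewrite minE -[b]trmxK; apply: rmin.
by rewrite inE /A/= trmxK.
Qed.

(* Main.v *)
(* In terms of the Gram matrix of [X] one has
   [|X d|^2 = (1 - rho)/2 (d_1 + d_2)^2 + (1 + rho)/2 (d_1 - d_2)^2].  Hence the
   squared compatibility constant is [1 - rho], attained at [(1/2, 1/2)].  For
   [t = lambda / (1 - rho)], the point [b0 - t (1, 1)] has nonnegative entries
   and [0] is a subgradient of the objective there; by strict convexity it is
   the unique minimizer. *)
Require Import Defs.
From mathcomp Require Import all_boot all_order all_algebra.
From mathcomp Require Import reals.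
From mathcomp Require Import ring lra.

Import Order.TTheory GRing.Theory Num.Theory.
Local Open Scope ring_scope.

Section TwoVariables.
Context {R : realType} {n : nat}.
Implicit Types (X : 'M[R]_(n, 2)) (b d : 'cV[R]_2).

Lemma l1norm2 b : l1norm b = `|b 0 0| + `|b 1 0|.
Proof.
rewrite /l1norm !big_ord_recl big_ord0 addr0.
by congr (`|b _ _| + `|b _ _|); exact/val_inj.
Qed.

(** Reduces everything to the Gram matrix of [X]: afterwards [n] disappears and only polynomials in
    two reals remain. *)
Lemma sqr_l2norm_mulmx2 X (rho : R) d :
  l2norm (col 0 X) = 1 -> l2norm (col 1 X) = 1 ->
  (col 0 X)^T *m col 1 X = (- rho)%:M ->
  l2norm (X *m d) ^+ 2
    = d 0 0 ^+ 2 + d 1 0 ^+ 2 - 2 * rho * (d 0 0 * d 1 0).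
Proof.
move=> X0 X1 /matrixP /(_ 0 0); rewrite !mxE eqxx mulr1n => X01.
move: (sqr_l2norm (col 0 X)) (sqr_l2norm (col 1 X)).
rewrite X0 X1 expr1n => {}X0 {}X1.
(* The coefficients 1, 1 and [- rho] become sums over the rows again, so that the identity can be
   checked row by row. *)
have <- : d 0 0 ^+ 2 * (\sum_(i < n) col 0 X i 0 ^+ 2)
    + d 1 0 ^+ 2 * (\sum_(i < n) col 1 X i 0 ^+ 2)
    + 2 * (d 0 0 * d 1 0) * (\sum_j (col 0 X)^T 0 j * col 1 X j 0)
    = d 0 0 ^+ 2 + d 1 0 ^+ 2 - 2 * rho * (d 0 0 * d 1 0).
  by rewrite -X0 -X1 X01; ring.
rewrite sqr_l2norm !mulr_sumr -!big_split /=.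
apply: eq_bigr => i _; rewrite !mxE !big_ord_recl big_ord0.
have -> : lift ord0 ord0 = 1 :> 'I_2 by exact/val_inj.
by rewrite -[ord0]/(0 : 'I_2); ring.
Qed.

Lemma full_compatibility2_two X (rho : R) :
  l2norm (col 0 X) = 1 -> l2norm (col 1 X) = 1 ->
  (col 0 X)^T *m col 1 X = (- rho)%:M -> 0 < rho < 1 ->
  full_compatibility2 X = 1 - rho.
Proof.
move=> X0 X1 X01 /andP[rho0 rho1].
have QE d := @sqr_l2norm_mulmx2 X rho d X0 X1 X01.
have [b b1 [phiE phi_min]] := full_compatibility2_min X isT.
apply/eqP; rewrite eq_le; apply/andP; split.
  have /phi_min : l1norm (const_mx 2^-1 : 'cV[R]_2) = 1.
    by rewrite l1norm2 !mxE ger0_norm; lra.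
  by move/le_trans; apply; rewrite QE !mxE; lra.
rewrite phiE QE; move: b1; rewrite l1norm2.
move: (b 0 0) (b 1 0) => x y xy1.
(* As [rho] is positive, replacing [x * y] by this bound can only lower the quadratic form. *)
have xyE : x * y <= `|x| * `|y| by rewrite -normrM ler_norm.
rewrite -(real_normK (num_real x)) -(real_normK (num_real y)).
have yE : `|y| = 1 - `|x| by lra.
(* This square says that [|x| (1 - |x|) <= 1/4], with equality at [|x| = 1/2]. *)
rewrite yE in xyE *; have := sqr_ge0 (`|x| - 2^-1).
nra.
Qed.

Lemma noiseless_lasso_two X (rho lambda : R) b0 b :
  l2norm (col 0 X) = 1 -> l2norm (col 1 X) = 1 ->
  (col 0 X)^T *m col 1 X = (- rho)%:M -> 0 < rho < 1 -> 0 < lambda ->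
  lambda / (1 - rho) <= b0 0 0 -> lambda / (1 - rho) <= b0 1 0 ->
  is_noiseless_lasso X b0 lambda b -> b = b0 - const_mx (lambda / (1 - rho)).
Proof.
move=> X0 X1 X01 /andP[rho0 rho1] lambda0.
set t := lambda / (1 - rho) => t0 t1 /(_ (b0 - const_mx t)).
have lambdaE : lambda = t * (1 - rho) by rewrite divfK //; apply/eqP; lra.
rewrite /lasso_objective !(sqr_l2norm_mulmx2 X rho) // !l1norm2 !mxE.
rewrite [`|b0 0 0 - t|]ger0_norm ?subr_ge0 //.
rewrite [`|b0 1 0 - t|]ger0_norm ?subr_ge0 //.
(* The deviation of [b] from the candidate. The two bounds that follow are the subgradient
   inequality for the l1 norm, tight at the candidate. *)
pose u := b 0 0 - b0 0 0 + t; pose v := b 1 0 - b0 1 0 + t.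
have b0E : lambda * b 0 0 <= lambda * `|b 0 0| by rewrite ler_pM2l ?ler_norm.
have b1E : lambda * b 1 0 <= lambda * `|b 1 0| by rewrite ler_pM2l ?ler_norm.
move=> opt.
(* The terms linear in [u] and [v] cancel because [lambda = t (1 - rho)]; what is left is the
   positive definite form [u^2 + v^2 - 2 rho u v]. *)
have {}opt : (1 - rho) * (u ^+ 2 + v ^+ 2) + rho * (u - v) ^+ 2 <= 0.
  by move: b0E b1E opt; rewrite /u /v lambdaE; lra.
have uv0 : u ^+ 2 + v ^+ 2 <= 0.
  rewrite -(pmulr_rle0 _ (_ : 0 < 1 - rho)); last lra.
  by have := mulr_ge0 (ltW rho0) (sqr_ge0 (u - v)); lra.
have u0 : u = 0.
  by apply/eqP; rewrite -sqrf_eq0 eq_le sqr_ge0 andbT; have := sqr_ge0 v; lra.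
have v0 : v = 0.
  by apply/eqP; rewrite -sqrf_eq0 eq_le sqr_ge0 andbT; have := sqr_ge0 u; lra.
apply/colP => i; rewrite !mxE; case: (unliftP 0 i) => [j|] ->.
  by rewrite ord1 (_ : lift 0 0 = 1); [rewrite /v in v0; lra | exact/val_inj].
by rewrite /u in u0; lra.
Qed.

End TwoVariables.

Theorem corollary6p1 (R : realType) (n : nat) (X : 'M[R]_(n, 2))
    (rho varphi2 lambda : R) (b0 bstar : 'cV[R]_2) :
  l2norm (col 0 X) = 1 ->
  l2norm (col 1 X) = 1 ->
  (col 0 X)^T *m col 1 X = (- rho)%:M ->
  0 < rho < 1 ->
  varphi2 = 1 - rho ->
  b0 1 0 <= b0 0 0 ->
  0 < b0 1 0 ->
  0 < lambda ->
  lambda / varphi2 <= b0 1 0 ->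
  is_noiseless_lasso X b0 lambda bstar ->
  l2norm (X *m (bstar - b0)) ^+ 2 + lambda * l1norm bstar
    = lambda * l1norm b0
  /\ l2norm (X *m (bstar - b0)) ^+ 2
    = lambda ^+ 2 * 2 / full_compatibility2 X.
Proof.
move=> X0 X1 X01 rho01 -> b01 b1_gt0 lambda0 t1 opt.
have t0 := le_trans t1 b01.
rewrite (full_compatibility2_two X rho) //.
rewrite (noiseless_lasso_two X rho lambda b0 bstar) //.
rewrite (sqr_l2norm_mulmx2 X rho) // !l1norm2 !mxE.
case/andP: rho01 => rho0 rho1.
have rhoN : 1 - rho != 0 by apply/eqP; lra.
have b0_gt0 := lt_le_trans b1_gt0 b01.
rewrite [`|b0 0 0 - _|]ger0_norm ?subr_ge0 //.
rewrite [`|b0 1 0 - _|]ger0_norm ?subr_ge0 //.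
(* The prediction error and [lambda] times the drop in l1 norm both equal
   [2 lambda^2 / (1 - rho)]. *)
by rewrite !gtr0_norm //; split; field.
Qed.
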